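(* Given three different points $(a,b,c)$ in the Riemann sphere, there exists a unique pair of Möbius transformations $(A,B)$ that are the canonical generators, for the parameters $(a,b,c)$, of a triangle group with signature $(0,3;\infty,2,2)$.
   Context: $|T|$ denotes the order of a Möbius transformation $T$, with parabolic elements regarded as elements of order $\infty$. A triangle group of signature $(0,3;\infty,2,2)$ is a (discrete) group of Möbius transformations generated by $A,B$ with $|A|=\infty$ ($A$ parabolic), $|B|=2$, $|AB|=2$. An element $A$ of a group $G$ of Möbius transformations is primitive if the only solutions of $B^n=A$ with $B\in G$, $n\in\mathbf Z$ are $B=A^{\pm1}$. Let $\Gamma$ be a triangle group with signature $(0,3;\infty,2,2)$. Generators $A$, $B$ of $\Gamma$ are canonical for the parameters $(a,b,c)$ if: 1) $|A|=\infty$, $|B|=2$, $|AB|=2$; 2) $A(a)=a$, $B(b)=b$, $AB(c)=c$; 3) $A$ and $B$ are primitive. *)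

(* Defs.v *)
From HB Require Import structures.
From mathcomp Require Import all_boot all_order all_algebra.
From mathcomp Require Import all_classical all_reals all_analysis.
From mathcomp Require Import complex ring.

Set Implicit Arguments.
Unset Strict Implicit.
Unset Printing Implicit Defensive.

Import Order.TTheory GRing.Theory Num.Theory.
Import numFieldNormedType.Exports.

Local Open Scope classical_set_scope.
Local Open Scope ring_scope.

(* The norm topology, which the library only attaches to R[i]^o. *)
HB.instance Definition _ (R : rcfType) := PseudoPointedMetric.copy R[i] R[i]^o.

(* The point at infinity is None. *)
Notation riemann_sphere R := (one_point_compactification R[i]).

(* z |-> (p z + q) / (r z + s), where M = [[p, q], [r, s]]. *)
Definition linear_fractional (R : realType) (M : 'M[R[i]]_2)
    (z : riemann_sphere R) : riemann_sphere R :=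
  let p := M 0 0 in let q := M 0 1 in let r := M 1 0 in let s := M 1 1 in
  match z with
  | Some w =>
      if r * w + s == 0 then None else Some ((p * w + q) / (r * w + s))
  | None => if r == 0 then None else Some (p / r)
  end.

Definition is_mobius (R : realType) (f : riemann_sphere R -> riemann_sphere R) :=
  exists2 M : 'M[R[i]]_2, M \in unitmx & f = linear_fractional M.

Section HomogeneousCoordinates.
Variable R : realType.
Local Notation C := R[i].
Implicit Types (M N : 'M[C]_2) (v : 'cV[C]_2) (z : riemann_sphere R).

Definition of_hom v : riemann_sphere R :=
  if v 1 0 == 0 then None else Some (v 0 0 / v 1 0).

Definition to_hom z : 'cV[C]_2 :=
  \col_(i < 2) (if i == 0 then (if z is Some w then w else 1)
                else (if z is Some _ then 1 else 0)).

Lemma ord2_eq10 : ((1 : 'I_2) == 0) = false.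
Proof. by []. Qed.

Lemma linear_fractionalE M z : linear_fractional M z = of_hom (M *m to_hom z).
Proof.
rewrite /of_hom !mxE !big_ord_recl !big_ord0 !mxE /=.
have -> : lift ord0 ord0 = 1 :> 'I_2 by apply/val_inj.
by case: z => [w|] /=; rewrite ?mulr1 ?mulr0 ?addr0.
Qed.

Lemma cV2P v v' : v 0 0 = v' 0 0 -> v 1 0 = v' 1 0 -> v = v'.
Proof.
move=> h0 h1; apply/matrixP => i j; rewrite (ord1 j).
case: i => [[|[|//]]] Hi.
- by rewrite (_ : Ordinal Hi = 0) //; apply/val_inj.
- by rewrite (_ : Ordinal Hi = 1) //; apply/val_inj.
Qed.

Lemma to_homK : cancel to_hom of_hom.
Proof.
by case=> [w|]; rewrite /of_hom !mxE ord2_eq10 /= ?oner_eq0 ?divr1 ?eqxx.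
Qed.

Lemma to_hom_neq0 z : to_hom z != 0.
Proof.
case: z => [w|]; apply/eqP => /matrixP.
- by move=> /(_ 1 0) /eqP; rewrite !mxE ord2_eq10 oner_eq0.
- by move=> /(_ 0 0) /eqP; rewrite !mxE oner_eq0.
Qed.

Lemma of_homZ (k : C) v : k != 0 -> of_hom (k *: v) = of_hom v.
Proof.
move=> k0; rewrite /of_hom !mxE mulf_eq0 (negPf k0) /=.
by case: eqP => // /eqP v0; congr Some; rewrite -mulf_div divff // mul1r.
Qed.

Lemma of_homK v : v != 0 -> exists2 k : C, k != 0 & to_hom (of_hom v) = k *: v.
Proof.
move=> v0; rewrite /of_hom; case: eqP => [v1|/eqP v1].
- have v00 : v 0 0 != 0.
    by apply: contra_neq v0 => v00; apply: cV2P; rewrite !mxE.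
  exists (v 0 0)^-1; first by rewrite invr_eq0.
  by apply: cV2P; rewrite !mxE ?ord2_eq10 /= ?v1 ?mulr0 // mulVf.
- exists (v 1 0)^-1; first by rewrite invr_eq0.
  by apply: cV2P; rewrite !mxE ?ord2_eq10 /= ?mulVf // mulrC.
Qed.

Lemma linear_fractionalM M N : N \in unitmx ->
  linear_fractional (M *m N) = linear_fractional M \o linear_fractional N.
Proof.
move=> uN; apply/funext => z; rewrite /= !linear_fractionalE.
have Nz0 : N *m to_hom z != 0.
  apply: contra_neq (to_hom_neq0 z) => Nz.
  by rewrite -(mulKmx uN (to_hom z)) Nz mulmx0.
have [k k0 ->] := of_homK Nz0.
by rewrite -scalemxAr of_homZ // mulmxA.
Qed.

Lemma linear_fractional1 : linear_fractional (1%:M : 'M[C]_2) = id.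
Proof. by apply/funext => z; rewrite linear_fractionalE mul1mx to_homK. Qed.

End HomogeneousCoordinates.

Record mobius (R : realType) := Mobius {
  mobius_fun :> riemann_sphere R -> riemann_sphere R;
  _ : `[< is_mobius mobius_fun >] }.

HB.instance Definition _ (R : realType) := [isSub for @mobius_fun R].
HB.instance Definition _ (R : realType) := [Choice of mobius R by <:].

Section MobiusGroup.
Variable R : realType.
Implicit Types f g : mobius R.

Lemma mobiusP f : is_mobius f.
Proof. by case: f => f /= /asboolP. Qed.

Lemma is_mobius_id : is_mobius (@id (riemann_sphere R)).
Proof. by exists 1%:M; rewrite ?unitmx1 // linear_fractional1. Qed.

Lemma is_mobius_comp f g : is_mobius (f \o g).
Proof.
case: (mobiusP f) => M uM ->; case: (mobiusP g) => N uN ->.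
by exists (M *m N); rewrite ?unitmx_mul ?uM // linear_fractionalM.
Qed.

Lemma is_mobius_inv f :
  exists g : mobius R, cancel f g /\ cancel g f.
Proof.
have [M uM fM] := mobiusP f.
have mV : is_mobius (linear_fractional (invmx M)).
  by exists (invmx M); rewrite ?unitmx_inv.
exists (Mobius (asboolT mV)); split=> z /=; rewrite fM.
- by rewrite -[LHS]/((linear_fractional _ \o linear_fractional M) z)
     -linear_fractionalM // mulVmx // linear_fractional1.
- by rewrite -[LHS]/((linear_fractional M \o linear_fractional _) z)
     -linear_fractionalM ?unitmx_inv // mulmxV // linear_fractional1.
Qed.

Definition mobius_one : mobius R := Mobius (asboolT is_mobius_id).
Definition mobius_mul f g : mobius R := Mobius (asboolT (is_mobius_comp f g)).
Definition mobius_inv f : mobius R := sval (cid (is_mobius_inv f)).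

Lemma mobius_mulA : associative mobius_mul.
Proof. by move=> f g h; apply/val_inj. Qed.
Lemma mobius_mul1 : left_id mobius_one mobius_mul.
Proof. by move=> f; apply/val_inj. Qed.
Lemma mobius_mulr1 : right_id mobius_one mobius_mul.
Proof. by move=> f; apply/val_inj. Qed.
Lemma mobius_mulV : left_inverse mobius_one mobius_inv mobius_mul.
Proof.
move=> f; apply/val_inj/funext => z /=; rewrite /mobius_inv.
by case: cid => g [/= fK _]; rewrite fK.
Qed.
Lemma mobius_mulrV : right_inverse mobius_one mobius_inv mobius_mul.
Proof.
move=> f; apply/val_inj/funext => z /=; rewrite /mobius_inv.
by case: cid => g [/= _ gK]; rewrite gK.
Qed.

HB.instance Definition _ := isGroup.Build (mobius R)
  mobius_mulA mobius_mul1 mobius_mulr1 mobius_mulV mobius_mulrV.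

End MobiusGroup.

Section Groups.
Variable G : groupType.
Implicit Types (x y : G) (H S : set G).
Local Open Scope group_scope.

Definition is_subgroup H := H 1 /\ forall x y, H x -> H y -> H (x / y).

Definition generated S : set G := smallest is_subgroup S.

Definition has_order x (n : nat) :=
  [/\ (0 < n)%N, x ^+ n = 1 & forall m, (0 < m < n)%N -> x ^+ m <> 1].

Definition zexpg x (n : int) : G :=
  match n with Posz m => x ^+ m | Negz m => x ^- m.+1 end.

Definition primitive_in H x :=
  H x /\ forall y (n : int), H y -> zexpg y n = x -> y = x \/ y = x^-1.

End Groups.

Section TriangleGroups.
Variable R : realType.
Implicit Types (A B T : mobius R) (Gamma : set (mobius R)).

Definition parabolic T := T <> 1%g /\ exists! z, T z = z.

(* The topology of PSL(2, C) is the quotient topology from SL(2, C), whose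
   projection is a covering map: a subset of PSL(2, C) is discrete exactly when
   its preimage in SL(2, C) is. *)
Definition discrete_mobius Gamma :=
  let lifts := [set M : 'M[R[i]]_2 | \det M = 1 /\
                  exists2 T, Gamma T & mobius_fun T = linear_fractional M] in
  lifts `<=` isolated lifts.

(* |A| = oo, |B| = 2, |AB| = 2, where order oo means parabolic. *)
Definition orders_inf22 A B :=
  [/\ parabolic A, has_order B 2 & has_order (A * B)%g 2].

Definition triangle_group_inf22 Gamma :=
  discrete_mobius Gamma /\
  exists A B, Gamma = generated [set A; B] /\ orders_inf22 A B.

Definition canonical_generators Gamma (a b c : riemann_sphere R) A B :=
  [/\ Gamma = generated [set A; B],
      orders_inf22 A B,
      [/\ A a = a, B b = b & (A * B)%g c = c]
    & primitive_in Gamma A /\ primitive_in Gamma B].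

End TriangleGroups.

(* Main.v *)
(* Moebius transformations act transitively on triples of distinct points, and
   all the notions involved are invariant under conjugation, so one may assume
   (a, b, c) = (oo, 0, 1). A parabolic A fixing oo is a translation z + t. An
   involution is represented by a matrix of trace 0; since B fixes 0, the traces
   of B and AB vanish only for B = -z, and then AB = t - z fixes 1 iff t = 2.
   Conversely z + 2 and -z generate the transformations (-1)^e z + 2 m, whose
   lifts to SL(2, C) are pairwise at distance at least 1. *)
Require Import Defs.
From mathcomp Require Import all_boot all_order all_algebra.
From mathcomp Require Import all_classical all_reals all_analysis.
From mathcomp Require Import complex ring zify.

Set Implicit Arguments.
Unset Strict Implicit.
Unset Printing Implicit Defensive.

Import Order.TTheory GRing.Theory Num.Theory.

Local Open Scope classical_set_scope.
Local Open Scope ring_scope.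

(** * Conjugation invariance in abstract groups *)

Section Conjugation.
Variable G : groupType.
Implicit Types (x y g : G) (H : set G).
Local Open Scope group_scope.

Lemma is_subgroup_generated (S : set G) : is_subgroup (generated S).
Proof.
split=> [H [[]] //|x y Sx Sy H HS].
by case: (HS) => -[_ HV] _; apply: HV; [exact: Sx | exact: Sy].
Qed.

Lemma is_subgroup_conj H g : is_subgroup H -> is_subgroup [set x | H (x ^ g)].
Proof.
by case=> H1 HV; split=> [|x y] /=; rewrite ?conj1g // conjMg conjVg; apply: HV.
Qed.

(** The preimage of a subgroup under conjugation is again a subgroup, so minimality gives one
    inclusion, for any conjugator [h]. Using it for both [g] and [g^-1] gives equality. *)
Lemma generated_conj x y g :
  generated [set x ^ g; y ^ g] = [set z | generated [set x; y] (z ^ g^-1)].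
Proof.
have sub (a b h : G) : generated [set a; b] `<=`
    [set z | generated [set a ^ h; b ^ h] (z ^ h)].
  apply: smallest_sub => [|w /= abw].
    exact: (@is_subgroup_conj (generated _) h (is_subgroup_generated _)).
  by apply: sub_gen_smallest; case: abw => ->; [left|right].
apply/seteqP; split=> z /=; first by move=> /(sub _ _ g^-1); rewrite /= !conjgK.
by move=> /(sub _ _ g); rewrite /= conjgKV.
Qed.

Lemma zexpg_conj x g n : zexpg (x ^ g) n = (zexpg x n) ^ g.
Proof. by case: n => n; rewrite /= ?conjVg conjXg. Qed.

Lemma has_order_conj x g n : has_order x n -> has_order (x ^ g) n.
Proof.
case=> n0 xn xm; split=> // [|m mn]; first by rewrite -conjXg xn conj1g.
rewrite -conjXg => /eqP; rewrite conjg_eq1 => /eqP; exact: xm.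
Qed.

Lemma primitive_in_conj H x g :
  primitive_in H x -> primitive_in [set z | H (z ^ g^-1)] (x ^ g).
Proof.
case=> Hx px; split=> [|y n /= Hy yn]; first by rewrite /= conjgK.
have [|<-|yE] := px _ n Hy; first by rewrite zexpg_conj yn conjgK.
- by left; rewrite conjgKV.
- by right; rewrite -conjVg -yE conjgKV.
Qed.

End Conjugation.

(** * Continuity of matrix multiplication, entry by entry *)

Section SmallMatrices.
Variable K : numFieldType.

Lemma small_mulmxl m n p (P : 'M[K]_(m, n)) (e : K) : 0 < e ->
  exists2 d : K, 0 < d & forall D : 'M[K]_(n, p),
    (forall i j, `|D i j| < d) -> forall i j, `|(P *m D) i j| < e.
Proof.
move=> e0; pose S : K := \sum_i \sum_l `|P i l|.
have S0 i : 0 <= \sum_l `|P i l| by apply: sumr_ge0.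
(* [S] dominates every row sum of [P]; the added 1 keeps the divisor positive even when [P] is
   zero. *)
have S1 : 0 < 1 + S by rewrite ltr_wpDr // sumr_ge0.
exists (e / (1 + S)) => [|D Dd i j]; first exact: divr_gt0.
rewrite mxE (le_lt_trans (ler_norm_sum _ _ _)) //.
apply: (@le_lt_trans _ _ (\sum_l `|P i l| * (e / (1 + S)))).
  by apply: ler_sum => l _; rewrite normrM ler_wpM2l // ltW.
rewrite -mulr_suml mulrA ltr_pdivrMr // mulrC ltr_pM2l //.
rewrite (@le_lt_trans _ _ S) ?ltrDr // /S (bigD1 i) //=.
by rewrite lerDl sumr_ge0.
Qed.

(** Multiplication on the right reduces to multiplication on the left by transposition. *)
Lemma small_mulmx m n p q (P : 'M[K]_(m, n)) (Q : 'M[K]_(p, q)) (e : K) :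
  0 < e -> exists2 d : K, 0 < d & forall D : 'M[K]_(n, p),
    (forall i j, `|D i j| < d) -> forall i j, `|(P *m D *m Q) i j| < e.
Proof.
move=> e0; have [d d0 Pd] := small_mulmxl q P e0.
have [d' d'0 Qd] := small_mulmxl n Q^T d0.
exists d' => // D Dd i j; rewrite -mulmxA; apply: Pd => k l.
have := Qd D^T; rewrite -trmx_mul => /(_ _ l k); rewrite mxE; apply=> r s.
by rewrite mxE.
Qed.

End SmallMatrices.

(** * Discreteness, parabolicity and canonical pairs under conjugation *)

Section Mobius.
Variable R : realType.
Local Notation C := R[i].
Implicit Types (M N P : 'M[C]_2) (z : riemann_sphere R) (T f g : mobius R).

(** Balls of matrices are entrywise, which turns isolation into an explicit estimate. The radius
    lies in [C], where [0 < e] forces it to be real. *)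
Lemma isolated_mxP (A : set 'M[C]_2) M :
  isolated A M <-> A M /\ exists2 e : C, 0 < e &
    forall N, A N -> (forall i j, `|M i j - N i j| < e) -> N = M.
Proof.
split=> [[/set_mem AM [V /nbhs_ballP[e e0 MV] VA]]|[AM [e e0 Me]]].
- split=> //; exists e => // N AN MN.
  have : (V `&` A) N by split=> //; apply: MV; split.
  by rewrite VA.
- split; first exact: mem_set.
  exists (ball M e); first exact: nbhsx_ballx.
  apply/seteqP; split=> [N [[_ MN] AN]|_ ->]; first exact: Me.
  by split=> //; apply: ballxx.
Qed.

Lemma mobius_eqP f g : f =1 g -> f = g.
Proof. by move=> fg; apply/val_inj/funext. Qed.

Lemma mobiusK g z : (g^-1)%g (g z) = z.
Proof. by rewrite -[LHS]/((g^-1 * g)%g z) mulVg. Qed.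

Lemma mobiusVK g z : g ((g^-1)%g z) = z.
Proof. by rewrite -[LHS]/((g * g^-1)%g z) mulgV. Qed.

Definition mobius_mx M (uM : M \in unitmx) : mobius R :=
  Mobius (asboolT (ex_intro2 _ _ M uM erefl)).

Lemma mobius_mxE M (uM : M \in unitmx) z :
  mobius_mx uM z = of_hom (M *m to_hom z).
Proof. exact: linear_fractionalE. Qed.

Lemma mobius_invE g P : P \in unitmx -> mobius_fun g = linear_fractional P ->
  mobius_fun g^-1%g = linear_fractional (invmx P).
Proof.
move=> uP gP; have uQ : invmx P \in unitmx by rewrite unitmx_inv.
suff <- : mobius_mx uQ = (g^-1)%g by [].
apply: (mulIg g); rewrite mulVg; apply/val_inj => /=.
by rewrite gP -linear_fractionalM // mulVmx // linear_fractional1.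
Qed.

(** With [P] a matrix of [g], the map [M |-> P M P^-1] sends lifts of the conjugated group to lifts
    of [Gamma]. It is continuous and injective, so isolation pulls back along it. *)
Lemma discrete_mobius_conj (Gamma : set (mobius R)) g :
  discrete_mobius Gamma -> discrete_mobius [set z | Gamma (z ^ g^-1)%g].
Proof.
move=> dG; have [P uP gP] := mobiusP g.
have lift M : \det M = 1 ->
  (exists2 T, Gamma (T ^ g^-1)%g & mobius_fun T = linear_fractional M) ->
  \det (P *m M *m invmx P) = 1 /\
  exists2 T, Gamma T & mobius_fun T = linear_fractional (P *m M *m invmx P).
- move=> dM [T GT TM]; have uM : M \in unitmx by rewrite unitmxE dM unitr1.
  split.
    by rewrite !det_mulmx det_inv dM mulr1 divrr // -unitmxE.
  exists (T ^ g^-1)%g => //.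
  have -> : mobius_fun (T ^ g^-1)%g = g \o T \o mobius_fun (g^-1)%g.
    by rewrite conjgE invgK.
  rewrite (mobius_invE uP gP) gP TM -linear_fractionalM //.
  by rewrite -linear_fractionalM // unitmx_inv.
move=> M [dM TM]; apply/isolated_mxP; split=> //.
have /isolated_mxP[_ [e e0 Me]] := dG _ (lift M dM TM).
have [d d0 small] := small_mulmx P (invmx P) e0.
exists d => // N [dN TN] MN.
have PNM : P *m N *m invmx P = P *m M *m invmx P.
  apply: Me => [|i j]; first exact: lift.
  rewrite (_ : _ - _ = (P *m (M - N) *m invmx P) i j); last first.
    by rewrite mulmxBr mulmxBl !mxE.
  by apply: small => k l; rewrite !mxE.
move/(congr1 (mulmxr P)): PNM => /=; rewrite !mulmxKV //.
by move/(congr1 (mulmx (invmx P))); rewrite !mulKmx.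
Qed.

(** [T ^ g] is [g^-1 * T * g], so its fixed points are the images under [g^-1] of those of [T]. *)
Lemma parabolic_conj T g : parabolic T -> parabolic (T ^ g)%g.
Proof.
case=> T1 [z [Tz zu]]; split.
  by move=> /eqP; rewrite conjg_eq1 => /eqP.
exists ((g^-1)%g z); split=> [|w Tw].
  by rewrite -[LHS]/((g^-1)%g (T (g ((g^-1)%g z)))) mobiusVK Tz.
rewrite (zu (g w)) ?mobiusK // -[in RHS]Tw.
by rewrite -[RHS]/(g ((g^-1)%g (T (g w)))) mobiusVK.
Qed.

Definition canonical_pair (a b c : riemann_sphere R) (A B : mobius R) :=
  exists Gamma : set (mobius R),
    triangle_group_inf22 Gamma /\ canonical_generators Gamma a b c A B.

Lemma canonical_pair_conj a b c A B g : canonical_pair a b c A B ->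
  canonical_pair ((g^-1)%g a) ((g^-1)%g b) ((g^-1)%g c) (A ^ g)%g (B ^ g)%g.
Proof.
move=> [Gamma [[dG _] [GE [pA oB oAB] [Aa Bb ABc] [prA prB]]]].
have GgE : [set z | Gamma (z ^ g^-1)%g] = generated [set A ^ g; B ^ g]%g.
  by rewrite generated_conj -GE.
have oAB' : orders_inf22 (A ^ g)%g (B ^ g)%g.
  split; [exact: parabolic_conj | exact: has_order_conj |].
  by rewrite -conjMg; exact: has_order_conj.
exists [set z | Gamma (z ^ g^-1)%g]; split.
  by split; [exact: discrete_mobius_conj | exists (A ^ g)%g, (B ^ g)%g].
split=> //; last by split; apply: primitive_in_conj.
split.
- by rewrite -[LHS]/((g^-1)%g (A (g ((g^-1)%g a)))) mobiusVK Aa.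
- by rewrite -[LHS]/((g^-1)%g (B (g ((g^-1)%g b)))) mobiusVK Bb.
- by rewrite -conjMg -[LHS]/((g^-1)%g ((A * B)%g (g ((g^-1)%g c))))
     mobiusVK ABc.
Qed.

(** * Matrices of Möbius maps, triples of points, and involutions *)

Lemma mx2P M N : M 0 0 = N 0 0 -> M 0 1 = N 0 1 -> M 1 0 = N 1 0 ->
  M 1 1 = N 1 1 -> M = N.
Proof.
move=> h00 h01 h10 h11; apply/matrixP => i j.
have ordP (k : 'I_2) : k = 0 \/ k = 1.
  by case: k => [[|[|//]] lt_k]; [left|right]; apply/val_inj.
by case: (ordP i) => ->; case: (ordP j) => ->.
Qed.

Lemma mulmx2E M (n : nat) (N : 'M[C]_(2, n)) i j :
  (M *m N) i j = M i 0 * N 0 j + M i 1 * N 1 j.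
Proof.
rewrite mxE !big_ord_recl big_ord0 addr0.
by congr (_ + _ * N _ _); [congr (M _ _)|]; apply/val_inj.
Qed.

Lemma det_mx2E M : \det M = M 0 0 * M 1 1 - M 0 1 * M 1 0.
Proof.
have l0 : lift ord0 ord0 = 1 :> 'I_2 by apply/val_inj.
have l1 : lift 1 ord0 = 0 :> 'I_2 by apply/val_inj.
rewrite (expand_det_row _ 0) !big_ord_recl big_ord0 /cofactor !det_mx11 !mxE.
by rewrite !l0 !l1 /= expr0 expr1 mul1r mulN1r mulrN addr0.
Qed.

Lemma linear_fractionalZ (k : C) M : k != 0 ->
  linear_fractional (k *: M) = linear_fractional M.
Proof.
by move=> k0; apply/funext=> z; rewrite !linear_fractionalE -scalemxAl of_homZ.
Qed.

(** Evaluation at oo, 0 and 1 gives in turn r = 0, q = 0 and p = s. *)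
Lemma linear_fractional_id M :
  linear_fractional M = id -> M = (M 0 0)%:M.
Proof.
move=> Mid.
have /= := congr1 (@^~ None) Mid; case: eqP => // r0 _.
have /= := congr1 (@^~ (Some 0)) Mid; rewrite mulr0 add0r.
case: eqP => // /eqP s0 []; rewrite mulr0 add0r => /eqP.
rewrite mulf_eq0 invr_eq0 (negPf s0) orbF => /eqP q0.
have /= := congr1 (@^~ (Some 1)) Mid; rewrite r0 q0 !mulr1 addr0 add0r.
rewrite (negPf s0) => -[] /(canRL (mulfVK s0)); rewrite mul1r => ps.
by apply: mx2P; rewrite !mxE //= ?r0 ?q0 ?mulr1n ?mulr0n.
Qed.

Lemma linear_fractional_inj M N : M \in unitmx -> N \in unitmx ->
  linear_fractional M = linear_fractional N -> exists k : C, M = k *: N.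
Proof.
move=> uM uN MN; have : linear_fractional (invmx N *m M) = id.
  rewrite linear_fractionalM // MN -linear_fractionalM // mulVmx //.
  exact: linear_fractional1.
move=> /linear_fractional_id; move: (fun_of_matrix _ _ _) => k NM.
by exists k; rewrite -(mulKVmx uN M) NM mul_mx_scalar.
Qed.

(** In homogeneous coordinates oo, 0 and 1 go to the first column of the matrix, the second column,
    and their sum. So lifts of [a] and [b] are scaled until they add up to a lift of [c]. *)
Lemma mobius_tripleP (a b c : riemann_sphere R) : a <> b -> b <> c -> a <> c ->
  exists f : mobius R, [/\ f None = a, f (Some 0) = b & f (Some 1) = c].
Proof.
move=> ab bc ac.
(* The determinant with columns [v] and [w], nonzero on lifts of distinct points. *)
pose d (v w : 'cV[C]_2) := v 0 0 * w 1 0 - v 1 0 * w 0 0.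
have d_neq0 (x y : riemann_sphere R) : x <> y -> d (to_hom x) (to_hom y) != 0.
  rewrite /d !mxE /=; case: x y => [x|] [y|] //= xy;
    rewrite ?(mul0r, mulr0, mulr1, mul1r) ?subr0 ?sub0r ?oppr_eq0 ?oner_eq0 //.
  by rewrite subr_eq0; apply/eqP => xE; apply: xy; rewrite xE.
have [[dcb dac] dab] := (d_neq0 _ _ (nesym bc), d_neq0 _ _ ac, d_neq0 _ _ ab).
have [[<- <-] <-] := (to_homK a, to_homK b, to_homK c).
move: (to_hom a) (to_hom b) (to_hom c) dcb dac dab => va vb vc dcb dac dab.
(* Cramer's rule: [d c b * a + d a c * b = d a b * c]. *)
pose P : 'M[C]_2 :=
  \matrix_(i, j) if j == 0 then d vc vb * va i 0 else d va vc * vb i 0.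
have uP : P \in unitmx.
  rewrite unitmxE det_mx2E unitfE !mxE /=.
  rewrite (_ : _ - _ = d vc vb * d va vc * d va vb); last by rewrite /d; ring.
  by rewrite !mulf_neq0.
exists (mobius_mx uP); split; rewrite mobius_mxE.
- rewrite (_ : P *m _ = d vc vb *: va) ?of_homZ //.
  by apply: cV2P; rewrite mulmx2E !mxE /=; ring.
- rewrite (_ : P *m _ = d va vc *: vb) ?of_homZ //.
  by apply: cV2P; rewrite mulmx2E !mxE /=; ring.
- rewrite (_ : P *m _ = d va vb *: vc) ?of_homZ //.
  by apply: cV2P; rewrite mulmx2E mxE [RHS]mxE /= !mxE /= /d; ring.
Qed.

(** The square of [M] is scalar. Its off-diagonal entries are the trace times those of [M], and its
    diagonal entries differ by the trace times the difference of those of [M]. A nonzero trace would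
    thus make [M] scalar and [T] trivial. *)
Lemma involution_trace T M : M \in unitmx ->
  mobius_fun T = linear_fractional M -> has_order T 2 -> M 0 0 + M 1 1 = 0.
Proof.
move=> uM TM [_ T2 T1].
have : linear_fractional (M *m M) = id.
  by rewrite linear_fractionalM // -TM -[RHS]/(mobius_fun (1 : mobius R)%g) -T2.
move=> /linear_fractional_id MM; apply/eqP/negPn/negP => tr0.
have M01 : M 0 1 = 0.
  apply/eqP; have /eqP := congr1 (fun X : 'M[C]_2 => X 0 1) MM.
  rewrite mulmx2E mxE /= mulr0n mulrC -mulrDr mulf_eq0.
  by rewrite (negPf tr0) orbF.
have M10 : M 1 0 = 0.
  apply/eqP; have /eqP := congr1 (fun X : 'M[C]_2 => X 1 0) MM.
  rewrite mulmx2E mxE /= mulr0n [X in _ + X]mulrC -mulrDr mulf_eq0.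
  by rewrite (negPf tr0) orbF.
have M11 : M 1 1 = M 0 0.
  have := congr1 (fun X : 'M[C]_2 => X 1 1) MM.
  rewrite /= mulmx2E mxE /= mulr1n mulmx2E M01 M10 !mul0r add0r addr0.
  move=> /eqP; rewrite -subr_eq0 -!expr2 subr_sqr [X in _ * X]addrC mulf_eq0.
  by rewrite (negPf tr0) orbF subr_eq0 => /eqP.
have ME : M = M 0 0 *: 1%:M.
  by apply: mx2P; rewrite !mxE /= ?M01 ?M10 ?M11 ?mulr1n ?mulr0n ?mulr1 ?mulr0.
have p0 : M 0 0 != 0.
  by apply: contra_neq tr0 => p0; rewrite M11 p0 addr0.
apply: (T1 1%N) => //; apply/val_inj => /=.
by rewrite TM ME linear_fractionalZ // linear_fractional1.
Qed.

(** * The infinite dihedral group and its discreteness *)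

Definition dihedral_mx (e : bool) (m : int) : 'M[C]_2 :=
  \matrix_(i, j) if i == 0 then (if j == 0 then (-1) ^+ e else 2 * m%:~R)
                 else (j == 1)%:R.

Lemma dihedral_mxE e m : [/\ dihedral_mx e m 0 0 = (-1) ^+ e,
  dihedral_mx e m 0 1 = 2 * m%:~R, dihedral_mx e m 1 0 = 0
  & dihedral_mx e m 1 1 = 1].
Proof. by rewrite !mxE. Qed.

Lemma dihedral_mx_unit e m : dihedral_mx e m \in unitmx.
Proof.
have [d00 d01 d10 d11] := dihedral_mxE e m.
by rewrite unitmxE det_mx2E d00 d10 d11 mulr0 subr0 mulr1 unitrX ?unitrN1.
Qed.

(* The elements [z |-> (-1)^e z + 2 m] of the group for [(oo, 0, 1)]. *)
Definition dihedral e m : mobius R := mobius_mx (dihedral_mx_unit e m).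

Lemma dihedralE e m z :
  dihedral e m z = omap (fun w => (-1) ^+ e * w + 2 * m%:~R) z.
Proof.
have [d00 d01 d10 d11] := dihedral_mxE e m.
rewrite mobius_mxE /of_hom !mulmx2E d00 d01 d10 d11 !mxE.
case: z => [w|] /=; first by rewrite mul0r add0r !mulr1 oner_eq0 divr1.
by rewrite !mul0r mulr0 addr0 eqxx.
Qed.

(** The value at 0 recovers [m], and then the value at 1 recovers [e]. *)
Lemma dihedral_inj e m e' m' :
  dihedral e m = dihedral e' m' -> e = e' /\ m = m'.
Proof.
have C2 : 2 != 0 :> C by rewrite pnatr_eq0.
move=> ee'; have := congr1 (fun T : mobius R => T (Some 0)) ee'.
rewrite !dihedralE /= !mulr0 !add0r => -[] /(mulfI C2) /intr_inj mm'.
split=> //; have := congr1 (fun T : mobius R => T (Some 1)) ee'.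
rewrite !dihedralE /= mm' !mulr1 => -[] /addIr.
exact: signr_inj.
Qed.

(** The law of the semidirect product of the integers by a group of order 2 acting by sign. *)
Lemma dihedralM e m e' m' : (dihedral e m * dihedral e' m')%g =
  dihedral (e (+) e') (m + (-1) ^+ e * m').
Proof.
apply: mobius_eqP => z; rewrite -[LHS]/(dihedral e m (dihedral e' m' z)).
rewrite !dihedralE; case: z => //= w; congr Some.
by rewrite signr_addb rmorphD rmorphM rmorph_sign /=; ring.
Qed.

Lemma dihedral1 : dihedral false 0 = 1%g.
Proof.
apply: mobius_eqP => -[w|]; rewrite dihedralE //=.
by rewrite expr0 mul1r mulr0 addr0.
Qed.

Lemma dihedralV e m : (dihedral e m)^-1%g = dihedral e (- ((-1) ^+ e * m)).
Proof.
apply: (mulgI (dihedral e m)); rewrite mulgV dihedralM addbb -dihedral1.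
by congr dihedral; rewrite mulrN mulrA -expr2 sqrr_sign mul1r subrr.
Qed.

Lemma dihedral_zexpg m n : zexpg (dihedral false m) n = dihedral false (m * n).
Proof.
have expE (k : nat) : (dihedral false m ^+ k)%g = dihedral false (m * k%:Z).
  elim: k => [|k IHk]; first by rewrite mulr0 dihedral1.
  by rewrite expgS IHk dihedralM expr0 mul1r intS mulrDr mulr1.
case: n => n /=; first exact: expE.
by rewrite expE dihedralV expr0 mul1r NegzE mulrN.
Qed.

(** Serves to control the powers of the half-turns [dihedral true m] when primitivity is checked. *)
Lemma zexpg_involutive (G : groupType) (x : G) (n : int) :
  (x * x)%g = 1%g -> zexpg x n = 1%g \/ zexpg x n = x.
Proof.
move=> xx; have xV : (x^-1)%g = x by apply: (mulgI x); rewrite mulgV xx.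
have expE (k : nat) : (x ^+ k)%g = 1%g \/ (x ^+ k)%g = x.
  elim: k => [|k [IHk|IHk]]; first by left.
  - by right; rewrite expgS IHk mulg1.
  - by left; rewrite expgS IHk.
case: n => n /=; first exact: expE.
by case: (expE n.+1) => ->; rewrite ?invg1 ?xV; [left|right].
Qed.

Definition dihedral_group : set (mobius R) :=
  [set T | exists e m, T = dihedral e m].

Lemma generated_dihedral (S : set (mobius R)) :
  S `<=` dihedral_group -> generated S `<=` dihedral_group.
Proof.
move=> SD; apply: smallest_sub => //; split.
  by exists false, 0; rewrite dihedral1.
move=> _ _ [e [m ->]] [e' [m' ->]]; rewrite dihedralV dihedralM.
by do 2![eexists].
Qed.

(** A lift has rows (1/k, 2mk) and (0, k) with k a fourth root of unity. Distinct values of k are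
    more than 1 apart, and for equal k the upper right entries differ by at least 2 in norm unless
    the integers agree; hence radius 1 isolates each lift. *)
Lemma discrete_dihedral (Gamma : set (mobius R)) :
  Gamma `<=` dihedral_group -> discrete_mobius Gamma.
Proof.
move=> GD.
have lift M : \det M = 1 ->
    (exists2 T, Gamma T & mobius_fun T = linear_fractional M) ->
  exists k (m : int), [/\ k ^+ 4 = 1, M 0 0 = k^-1, M 0 1 = 2 * m%:~R * k,
    M 1 0 = 0 & M 1 1 = k].
- move=> dM [T /GD[e [m ->]]] TM.
  have uM : M \in unitmx by rewrite unitmxE dM unitr1.
  (* [dihedral_mx e m] has determinant [(-1) ^+ e], so a lift of determinant 1 is only a scalar
     multiple of it. *)
  have [k ME] := linear_fractional_inj uM (dihedral_mx_unit e m) (esym TM).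
  have [d00 d01 d10 d11] := dihedral_mxE e m.
  have M11 : M 1 1 = k by rewrite ME mxE d11 mulr1.
  have M10 : M 1 0 = 0 by rewrite ME mxE d10 mulr0.
  have M01 : M 0 1 = 2 * m%:~R * k by rewrite ME mxE d01 mulrC.
  have M00 : M 0 0 = k * (-1) ^+ e by rewrite ME mxE d00.
  move: dM; rewrite det_mx2E M10 mulr0 subr0 M11 => k1.
  have k0 : k != 0.
    by apply: contra_eq_neq k1 => ->; rewrite mulr0 eq_sym oner_eq0.
  exists k, m; split=> //; last by rewrite -[LHS](mulfK k0) k1 div1r.
  (* The determinant condition is [k ^+ 2 * (-1) ^+ e = 1]; squaring removes the sign. *)
  rewrite (_ : k ^+ 4 = (k * (-1) ^+ e * k) ^+ 2).
    by rewrite -M00 k1 expr1n.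
  by rewrite mulrAC exprMn sqrr_sign mulr1 -expr2 -exprM.
move=> M liftM; have [dM TM] := liftM; apply/isolated_mxP; split=> //.
exists 1 => [//|N [dN TN] MN].
have [k [m [k4 M00 M01 M10 M11]]] := lift M dM TM.
have [l [n [l4 N00 N01 N10 N11]]] := lift N dN TN.
have norm1 (x : C) : x ^+ 4 = 1 -> `|x| = 1.
  by move=> x4; apply/eqP; rewrite -(@pexpr_eq1 _ _ 4) // -normrX x4 normr1.
have lk : l = k.
  have k0 : k != 0 by rewrite -normr_eq0 norm1 // oner_eq0.
  have := MN 1 1; rewrite M11 N11.
  (* Since k has norm 1, the ratio [u] is a fourth root of unity at distance less than 1 from 1. *)
  pose u := l / k; have u4 : u ^+ 4 = 1 by rewrite exprMn exprVn k4 l4 divr1.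
  have -> : l = u * k by rewrite mulfVK.
  rewrite -{1}[k]mul1r -mulrBl normrM (norm1 _ k4) mulr1 => u1.
  have u1' : `|1 - u| * `|1 + u| < 2.
    rewrite -[2]mul1r; apply: le_lt_trans (_ : _ <= `|1 - u| * 2) _.
      rewrite ler_wpM2l // (le_trans (ler_normD _ _)) //.
      by rewrite normr1 norm1.
    by rewrite ltr_pM2r.
  (* The first factor gives [u = 1]. If [u = -1], then [1 - u = 2] contradicts [u1]; if
     [u ^+ 2 = -1], then [1 - u ^+ 2 = 2] contradicts [u1']. *)
  have : (1 - u) * (1 + u) * (1 + u ^+ 2) = 1 - u ^+ 4 by ring.
  rewrite u4 subrr => /eqP; rewrite !mulf_eq0 -orbA => /or3P[||] /eqP u0.
  - by move/eqP: u0; rewrite subr_eq0 => /eqP <-; rewrite mul1r.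
  - move: u1; have -> : 1 - u = 2 by rewrite -[1 - u]addr0 -u0; ring.
    by rewrite normr_nat ltrn1.
  - move: u1'; rewrite -normrM (_ : _ * _ = 2) ?normr_nat ?ltxx //.
    by rewrite -[LHS]addr0 -u0; ring.
have mn : n = m.
  (* Now that the scalars agree, the entries differ by [2 * |m - n|] in norm, an even integer below
     1. *)
  have := MN 0 1; rewrite M01 N01 lk -mulrBl -mulrBr -rmorphB /= !normrM.
  rewrite (norm1 _ k4) mulr1 normr_nat -intr_norm.
  rewrite -[2]/(2%:~R) -intrM -[1]/(1%:~R) ltr_int.
  by lia.
by apply: mx2P; rewrite ?M00 ?M01 ?M10 ?M11 ?N00 ?N01 ?N10 ?N11 ?lk ?mn.
Qed.

(** * Existence and uniqueness for the triple (oo, 0, 1) *)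

Lemma canonical_pair_dihedral :
  canonical_pair None (Some 0) (Some 1) (dihedral false 1) (dihedral true 0).
Proof.
set A := dihedral false 1; set B := dihedral true 0.
have AB : (A * B)%g = dihedral true 1 by rewrite dihedralM mulr0 addr0.
have inv m : has_order (dihedral true m) 2.
  split=> // [|[|[|k]]] //.
    by rewrite expg2 dihedralM expr1 mulN1r subrr dihedral1.
  by rewrite expg1 -dihedral1 => _ /dihedral_inj[].
have D : generated [set A; B] `<=` dihedral_group.
  by apply: generated_dihedral => T [] ->; do 2![eexists].
have oAB : orders_inf22 A B.
  split; [split | exact: inv | by rewrite AB; exact: inv].
    by rewrite -dihedral1 => /dihedral_inj[].
  exists None; split=> [|[w|]]; rewrite dihedralE //= => -[] /eqP.
  by rewrite expr0 mul1r -subr_eq0 addrC addKr mulr1 pnatr_eq0.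
have Dinv m : (dihedral true m * dihedral true m)%g = 1%g.
  by rewrite -expg2; case: (inv m).
exists (generated [set A; B]); split.
  by split; [exact: discrete_dihedral | exists A, B].
split=> //; first split.
- by rewrite dihedralE.
- by rewrite dihedralE /= !mulr0 addr0.
- by rewrite AB dihedralE /= expr1 !mulr1 addrC; congr Some; ring.
split; split.
- by apply: sub_gen_smallest; left.
(* A half-turn [y] has only the powers 1 and [y]. A translation by [2 * m] with [n]-th power [A] has
   [m * n = 1], so [m] is a unit and [y] is [A] or its inverse. *)
- move=> y n /D[[] [m ->]].
    case: (zexpg_involutive n (Dinv m)) => -> A1; last by left.
    by move: A1; rewrite -dihedral1 => /dihedral_inj[].
  rewrite dihedral_zexpg => /dihedral_inj[_ mn].
  have /eqP := congr1 absz mn; rewrite abszM muln_eq1 => /andP[/eqP m1 _].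
  have [->|->] : m = 1 \/ m = -1 by lia.
    by left.
  by right; rewrite dihedralV expr0 mul1r.
- by apply: sub_gen_smallest; right.
(* Powers of translations are translations, so only half-turns can be roots of [B]. *)
- move=> y n /D[[] [m ->]].
    case: (zexpg_involutive n (Dinv m)) => -> B1; last by left.
    by move: B1; rewrite -dihedral1 => /dihedral_inj[].
  by rewrite dihedral_zexpg => /dihedral_inj[].
Qed.

Lemma canonical_pair_unique A B : canonical_pair None (Some 0) (Some 1) A B ->
  A = dihedral false 1 /\ B = dihedral true 0.
Proof.
case=> Gamma [_ [_ [[A1 [w [_ wu]]] oB oAB] [Aoo B0 AB1] _]].
have [M uM AM] := mobiusP A; have [N uN BN] := mobiusP B.
have M10 : M 1 0 = 0 by move: Aoo; rewrite AM /=; case: eqP.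
have [M00 M11] : M 0 0 != 0 /\ M 1 1 != 0.
  move: uM; rewrite unitmxE det_mx2E M10 mulr0 subr0 unitfE mulf_eq0.
  by move=> /norP.
(* Unequal diagonal entries would give the finite fixed point [x] besides oo. *)
have {}M00 : M 0 0 = M 1 1.
  apply/eqP; rewrite -subr_eq0; apply/negPn/negP => pr0.
  pose x := M 0 1 / (M 1 1 - M 0 0).
  have x0 : M 1 1 - M 0 0 != 0 by rewrite -oppr_eq0 opprB.
  have Ax : A (Some x) = Some x.
    rewrite AM /= M10 mul0r add0r (negPf M11); congr Some.
    by rewrite /x; field; rewrite x0.
  by have := wu _ Ax; rewrite (wu _ Aoo).
pose t := M 0 1 / M 1 1.
have AE z : A z = omap (fun w => w + t) z.
  rewrite AM; case: z => [z|] /=; rewrite M10; last by rewrite eqxx.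
  rewrite mul0r add0r (negPf M11); congr Some.
  by rewrite /t M00; field.
have t0 : t != 0.
  apply/eqP => t0; apply: A1; apply: mobius_eqP => -[z|]; rewrite AE //=.
  by rewrite t0 addr0.
have M01 : M 0 1 != 0 by apply: contra_neq t0; rewrite /t => ->; rewrite mul0r.
have [N11 N01] : N 1 1 != 0 /\ N 0 1 = 0.
  move: B0; rewrite BN /= !mulr0 !add0r; case: eqP => // /eqP N11 [] /eqP.
  by rewrite mulf_eq0 invr_eq0 (negPf N11) orbF => /eqP.
have N00 : N 0 0 = - N 1 1.
  by apply/eqP; rewrite -addr_eq0; apply/eqP/(involution_trace uN BN oB).
have N10 : N 1 0 = 0.
  have uMN : M *m N \in unitmx by rewrite unitmx_mul uM.
  have ABE : mobius_fun (A * B)%g = linear_fractional (M *m N).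
    by rewrite linear_fractionalM // -AM -BN.
  have := involution_trace uMN ABE oAB.
  (* The trace of [M *m N] collapses to [M 0 1 * N 1 0], and [M 0 1] is nonzero because the
     translation is nontrivial. *)
  rewrite !mulmx2E M10 N01 N00 M00 mulrN mul0r add0r addrAC addNr add0r.
  by move/eqP; rewrite mulf_eq0 (negPf M01) => /eqP.
have BE z : B z = omap -%R z.
  rewrite BN; case: z => [z|] /=; rewrite N10; last by rewrite eqxx.
  rewrite mul0r add0r (negPf N11) N01 N00 addr0; congr Some.
  by field.
have t2 : t = 2.
  move: AB1; rewrite -[LHS]/(A (B (Some 1))) BE AE /= => -[] /eqP.
  by rewrite addrC subr_eq => /eqP.
split; apply: mobius_eqP => -[z|]; rewrite dihedralE ?AE ?BE //=.
  by rewrite t2 expr0 mul1r mulr1.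
by rewrite expr1 mulN1r mulr0 addr0.
Qed.

End Mobius.

(** * Transport from (oo, 0, 1) to an arbitrary triple *)

Theorem theorem4 (R : realType) (a b c : riemann_sphere R)
    (hab : a <> b) (hbc : b <> c) (hac : a <> c) :
  exists! AB : mobius R * mobius R,
    exists Gamma : set (mobius R),
      triangle_group_inf22 Gamma /\
      canonical_generators Gamma a b c AB.1 AB.2.
Proof.
have [g [<- <- <-]] := mobius_tripleP hab hbc hac.
(* Conjugating by [g^-1] yields [g * A * g^-1], which moves fixed points by [g]. *)
exists (dihedral R false 1 ^ g^-1, dihedral R true 0 ^ g^-1)%g; split=> /=.
  have := canonical_pair_conj g^-1%g (canonical_pair_dihedral R).
  by rewrite invgK.
(* Conjugating any other pair by [g] brings it back to the normalised triple. *)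
move=> [A B] /= /(canonical_pair_conj g).
by rewrite !mobiusK => /canonical_pair_unique[<- <-]; rewrite !conjgK.
Qed.
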